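(* Let $(\Omega,\mathcal G,\mathbb P)$ be a probability space, $\mathcal F=(\mathcal F_n)_{n\in\mathbb N_0}$ a filtration on $\Omega$ with $\mathcal F_\infty\subset\mathcal G$, $(E,\mathcal E)$ a measurable space, and $Y=(Y_n)_{n\in\mathbb N}$ an $\mathcal F$-adapted sequence of $(E,\mathcal E)$-valued random elements such that for every $i\in\mathbb N_0$, $Y_{i+1}$ is independent of $\mathcal F_i$ and has the same law as $Y_1$. Let $\mathcal L$ be the law of $Y$ on $(E^{\mathbb N},\mathcal E^{\otimes\mathbb N})$. Let $R:\Omega\to\mathbb N_0\cup\{\infty\}$ be $\mathcal G$-measurable with $\mathbb P(R<\infty)>0$. Consider the statements: (a) $\mathcal F_R'$ is independent of $\Box_RY$ under $\mathbb P'$; (b) there are $G\in\mathcal E^{\otimes\mathbb N}$ and, for every $n\in\mathbb N_0$ with $\mathbb P(R=n)>0$, an $F_n\in\mathcal F_n$, such that a.s. $\{R=n\}=F_n\cap\{\Box_nY\in G\}$; (i) $\mathcal F_R'$ is independent of $\Box_RY$ under $\mathbb P'$ and the law of $\Box_RY$ under $\mathbb P'$ is $\mathcal L$; (ii) $R$ is a stopping time relative to the completion of $\mathcal F$. Then (b) implies (a), and (ii) implies (i). If in addition $\{R=n\}\in\overline{\mathcal F_n\vee\sigma(\Box_nY)}$ for each $n\in\mathbb N_0$, then (a) implies (b) and (i) implies (ii). Moreover, when (b) holds, $G$ is $\mathcal L$-a.s. unique, the $F_n$ are a.s. unique, and the law of $\Box_RY$ under $\mathbb P'$ equals $\mathbb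 P(Y\in\cdot\mid Y\in G)=\mathcal L(\cdot\mid G)$.
   Context: For $n\in\mathbb N_0$, $\Box_nY:=(Y_{n+i})_{i\in\mathbb N}$, and on $\{R<\infty\}$, $\Box_RY:=(Y_{R+i})_{i\in\mathbb N}$. $\mathcal F_R'$ is the $\sigma$-field on $\{R<\infty\}$ generated by the maps $Z_R$ (restricted to $\{R<\infty\}$) as $Z$ ranges over all $\mathcal F$-adapted real-valued processes $Z=(Z_n)_{n\in\mathbb N_0}$. $\mathbb P'$ is the probability $A\mapsto\mathbb P(A\mid R<\infty)$ on the trace $\sigma$-field $\mathcal G|_{\{R<\infty\}}$. For a sub-$\sigma$-field $\mathcal H\subset\mathcal G$, $\overline{\mathcal H}$ denotes the $\sigma$-field generated by $\mathcal H$ and the $\mathbb P$-negligible sets of $\mathcal G$; the completion of a filtration is obtained by completing each member. ''a.s.'' refers to $\mathbb P$. *)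

(* Defs.v *)
From HB Require Import structures.
From mathcomp Require Import all_boot all_order all_algebra.
From mathcomp Require Import all_classical all_reals all_analysis.
Set Implicit Arguments. Unset Strict Implicit. Unset Printing Implicit Defensive.
Import Order.TTheory GRing.Theory Num.Theory.
Local Open Scope classical_set_scope.
Local Open Scope ring_scope.

(* Sequences (Y_1, Y_2, ...) in E^N are represented as functions s : nat -> E,
   where s i stands for the (i+1)-th term. *)

Definition prod_sigma {dE} (E : measurableType dE) : set (set (nat -> E)) :=
  <<s \bigcup_(i in [set: nat]) preimage_set_system setT (fun s : nat -> E => s i) measurable >>.
Arguments prod_sigma {dE} E.

Definition sigma_of {T U : Type} (D : set T) (M : set (set U)) (f : T -> U) :
  set (set T) := preimage_set_system D f M.

Section defs.
Context {d : measure_display} {Omega : measurableType d} {R : realType}.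
Context {dE : measure_display} {E : measurableType dE}.
Variable P : probability Omega R.

Definition filtration (F : nat -> set (set Omega)) :=
  (forall n, sigma_algebra setT (F n)) /\
  (forall n, F n `<=` measurable) /\
  (forall n m, (n <= m)%N -> F n `<=` F m).

(* shifted sequence  Box_n Y = (Y_{n+i})_{i >= 1};  Y k stands for Y_k (k >= 1) *)
Definition Box (Y : nat -> Omega -> E) (n : nat) : Omega -> (nat -> E) :=
  fun w i => Y (n + i.+1)%N w.

(* random time R : Omega -> N_0 u {oo}, None = oo *)
Definition Rfin (T : Omega -> option nat) : set Omega := [set w | T w <> None].
Definition Req (T : Omega -> option nat) (n : nat) : set Omega := [set w | T w = Some n].

(* Box_R Y on {R < oo} (arbitrary value with R := 0 outside, irrelevant) *)
Definition BoxR (Y : nat -> Omega -> E) (T : Omega -> option nat) : Omega -> (nat -> E) :=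
  fun w => Box Y (odflt 0%N (T w)) w.

Definition adapted_real (F : nat -> set (set Omega)) (Z : nat -> Omega -> R) :=
  forall n (B : set R), measurable B -> F n (Z n @^-1` B).

Definition F_R' (F : nat -> set (set Omega)) (T : Omega -> option nat) : set (set Omega) :=
  <<s Rfin T, \bigcup_(Z in adapted_real F)
       preimage_set_system (Rfin T) (fun w => Z (odflt 0%N (T w)) w) measurable >>.

Definition condP (D A : set Omega) : R := fine (P (A `&` D)) / fine (P D).

Definition indep_under (D : set Omega) (A B : set (set Omega)) :=
  forall a b, A a -> B b -> condP D (a `&` b) = condP D a * condP D b.

Definition as_eq (A B : set Omega) := P.-negligible ((A `\` B) `|` (B `\` A)).

Definition completion (H : set (set Omega)) : set (set Omega) :=
  <<s H `|` [set N | measurable N /\ P N = 0%E] >>.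

Definition join (H1 H2 : set (set Omega)) : set (set Omega) := <<s H1 `|` H2 >>.

Definition stmt_a F Y T :=
  indep_under (Rfin T) (F_R' F T) (sigma_of (Rfin T) (prod_sigma E) (BoxR Y T)).

Definition b_witness F Y T (G : set (nat -> E)) (Fs : nat -> set Omega) :=
  prod_sigma E G /\
  forall n, (0 < P (Req T n))%E ->
    F n (Fs n) /\ as_eq (Req T n) (Fs n `&` (Box Y n @^-1` G)).

Definition stmt_b F Y T := exists G Fs, b_witness F Y T G Fs.

Definition stmt_i F Y T :=
  stmt_a F Y T /\
  forall B, prod_sigma E B ->
    condP (Rfin T) (BoxR Y T @^-1` B) = fine (P (Box Y 0 @^-1` B)).

Definition stmt_ii F (T : Omega -> option nat) :=
  forall n, completion (F n) [set w | exists k, T w = Some k /\ (k <= n)%N].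

End defs.

(* Main.v *)
(* Independence of Y_(i+1) from F_i gives P(A, Box_n Y in S) = P(A) L(S) for A in F_n,
   by a pi-lambda argument from cylinders.  Slicing over the values of R, (b)
   then gives P(A, Box_R Y in B) = c_A L(G & B) for every A in F_R', which is
   both (a) and the formula for the law of Box_R Y; (ii) is (b) with G
   everything.

   For (a) => (b), let Q be the law of Box_R Y under P', let G be the complement
   of a Q-null set of maximal L-measure, and let F_n be the complement of an
   element of F_n null for alpha := P( . & {R = n}) and of maximal P-measure.
   Then {R = n} lies almost surely in F_n & {Box_n Y in G}.  By (a), the law of
   (omega, Box_n Y) restricted to {R = n} is the product alpha x Q, and on
   F_n x G the alpha x Q-null sets are P x L-null (look at the sections);
   hence (F_n & {Box_n Y in G}) \ {R = n}, which is null for the former, is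
   P-null.  This avoids Radon-Nikodym densities. *)
Require Import Defs.
From HB Require Import structures.
From mathcomp Require Import all_boot all_order all_algebra.
From mathcomp Require Import all_classical all_reals all_analysis.
From mathcomp Require Import measurable_realfun ring.
Import Order.TTheory GRing.Theory Num.Theory.
Local Open Scope classical_set_scope.
Local Open Scope ring_scope.

(** * Supports of finite measures and null sets of product measures *)

Section null_sets.
Local Open Scope ereal_scope.
Context {R : realType}.

(* Exhaustion: [~` S] is a [mu]-null set of maximal [nu]-measure. *)
Lemma exists_support {d} {T : measurableType d}
    (mu nu : {finite_measure set T -> \bar R}) :
  exists S : set T, [/\ measurable S, mu (~` S) = 0 &
    forall B, measurable B -> B `<=` S -> mu B = 0 -> nu B = 0].
Proof.
pose V := [set x : R | exists N, [/\ measurable N, mu N = 0 & x = fine (nu N)]].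
have nufin A : measurable A -> nu A \is a fin_num by move=> mA; exact: fin_num_measure.
have V0 : V 0%R by exists set0; rewrite !measure0.
have supV : has_sup V.
  split; first by exists 0%R.
  exists (fine (nu setT)) => _ [N [mN _ ->]].
  by rewrite fine_le ?nufin ?le_measure ?inE.
have /choice[N Nk] : forall k : nat, exists N : set T,
    [/\ measurable N, mu N = 0 & (sup V - k.+1%:R^-1 < fine (nu N))%R].
  move=> k; have k0 : (0 < k.+1%:R^-1 :> R)%R by rewrite invr_gt0.
  by have [_ [N [mN N0 ->]] ltN] := sup_adherent k0 supV; exists N.
have mN k : measurable (N k) by case: (Nk k).
have mUN : measurable (\bigcup_k N k) by exact: bigcupT_measurable.
(* A countable union of near-optimal null sets is again null, so the supremum is attained. *)
have supUN : (sup V <= fine (nu (\bigcup_k N k)))%R.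
  apply/ler_addgt0Pl => e e0.
  have [k ke] : exists k : nat, (k.+1%:R^-1 < e)%R.
    by have [k _ /(_ k (leqnn _)) /= ke] := near_infty_natSinv_lt (PosNum e0); exists k.
  have [_ _ ltN] := Nk k.
  have le1 : (fine (nu (N k)) <= fine (nu (\bigcup_k N k)))%R.
    by rewrite fine_le ?nufin ?le_measure ?inE//; exact: bigcup_sup.
  by rewrite -lerBlDl; apply: le_trans le1; apply: le_trans (ltW ltN); rewrite lerB// ltW.
have UN0 : mu (\bigcup_k N k) = 0.
  apply: measure_negligible => //; apply: negligible_bigcup => k.
  by apply/negligibleP => //; case: (Nk k).
exists (~` \bigcup_k N k); split; first exact: measurableC.
  by rewrite setCK.
move=> B mB BN B0.
(* Adjoining [B] keeps the union [mu]-null, so its [nu]-mass stays below the supremum; [B] is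
   disjoint from the union, which leaves no mass for it. *)
have leV : (fine (nu ((\bigcup_k N k) `|` B)) <= sup V)%R.
  apply: sup_upper_bound => //; exists ((\bigcup_k N k) `|` B); split => //.
    exact: measurableU.
  apply: measure_negligible; first exact: measurableU.
  by apply: negligibleU; exact/negligibleP.
have := le_trans leV supUN.
rewrite measureU//; last by apply/seteqP; split => // x [Nx /BN].
rewrite fineD ?nufin// gerDl => nuB.
apply/eqP; rewrite eq_le measure_ge0 andbT -[X in X <= _]fineK ?nufin//.
Qed.

(** Restricting [mu] to the whole space keeps its values and supplies the finite-measure structure
    that the lemmas on null sets take as input. *)
Lemma exists_finite_measure {d} {T : measurableType d}
    (mu : {measure set T -> \bar R}) : mu setT < +oo ->
  exists nu : {finite_measure set T -> \bar R}, forall A, nu A = mu A.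
Proof.
by move=> muT; exists (mfrestr measurableT muT) => A; rewrite -[in RHS](setIT A).
Qed.

Lemma exists_pushforward {d1 d2} {T1 : measurableType d1}
    {T2 : measurableType d2} (mu : {measure set T1 -> \bar R}) (f : T1 -> T2) :
  measurable_fun setT f -> mu setT < +oo ->
  exists nu : {finite_measure set T2 -> \bar R}, forall A, nu A = mu (f @^-1` A).
Proof.
move=> mf muT.
apply: (@exists_finite_measure _ _ (pushforward mu f)) => //.
Qed.

(** For [m1]-almost every x the section of [C] is [m2]-null. The exceptional x lie in [S1], because
    sections outside [S1] are empty, hence they form an [n1]-null set; every other section lies in
    [S2] and is thus [n2]-null. *)
Lemma product_measure_null {d1 d2} {T1 : measurableType d1}
    {T2 : measurableType d2} (m1 n1 : {finite_measure set T1 -> \bar R})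
    (m2 n2 : {finite_measure set T2 -> \bar R}) (S1 : set T1) (S2 : set T2)
    (C : set (T1 * T2)) :
  measurable S1 -> measurable S2 ->
  (forall B, measurable B -> B `<=` S1 -> m1 B = 0 -> n1 B = 0) ->
  (forall B, measurable B -> B `<=` S2 -> m2 B = 0 -> n2 B = 0) ->
  measurable C -> C `<=` S1 `*` S2 ->
  (m1 \x m2) C = 0 -> (n1 \x n2) C = 0.
Proof.
move=> mS1 mS2 mn1 mn2 mC CS C0.
pose B1 := [set x | m2 (xsection C x) != 0].
have mf := measurable_fun_xsection m2 mC.
have m0 : measurable ([set~ 0] : set (\bar R)).
  by apply: measurableC; exact: emeasurable_set1.
have mB1 : measurable B1.
  rewrite (_ : B1 = setT `&` (m2 \o xsection C) @^-1` (~` [set 0])).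
    exact: mf.
  by rewrite setTI; apply/seteqP; split => x /= /eqP.
have B1S : B1 `<=` S1.
  move=> x; apply: contraPP => S1x; apply/negP; rewrite negbK; apply/eqP.
  rewrite (_ : xsection C x = set0) ?measure0//.
  by apply/seteqP; split => // y; rewrite /xsection/= inE => /CS[].
have n1B : n1 B1 = 0.
  apply: mn1 => //.
  have : \int[m1]_x `|(m2 \o xsection C) x| = 0.
    rewrite -[RHS]C0; apply: eq_integral => x _; rewrite gee0_abs//=.
  move/ae_eq_integral_abs => /(_ measurableT mf) [N [mN N0 BN]].
  apply: (subset_measure0 mB1 mN _ N0) => x /= B1x; apply: BN => /= /(_ I) /eqP.
  by rewrite (negbTE B1x).
have mg := measurable_fun_xsection n2 mC.
rewrite /product_measure1 (eq_integral (fun x => `|(n2 \o xsection C) x|)); last first.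
  by move=> x _; rewrite gee0_abs//=.
apply/ae_eq_integral_abs => //.
exists B1; split => // x /= H; apply/eqP => C0x; apply: H => _.
apply: mn2 => //; first exact: measurable_xsection.
by move=> y; rewrite /xsection/= inE => /CS[].
Qed.
End null_sets.

(** * Events determined by two independent maps *)

Section factorization.
Local Open Scope ereal_scope.
Context {d d1 d2} {Omega : measurableType d} {T1 : measurableType d1}
  {T2 : measurableType d2} {R : realType} (P : probability Omega R).

(** [S1] supports the law of [X1] on [D] relative to its law under [P], so [D] lies a.s. in the
    rectangle. The part of the rectangle outside [D'] is null for the law of the pair on [D], a
    product by [indD]; [product_measure_null] makes it null for the law of the pair under [P], a
    product by [indP]. *)
Lemma as_eq_rectangle (X1 : Omega -> T1) (X2 : Omega -> T2) (D : set Omega)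
    (Q : {measure set T2 -> \bar R}) (S2 : set T2) (D' : set (T1 * T2)) :
  measurable_fun setT X1 -> measurable_fun setT X2 -> measurable D ->
  (forall A B, measurable A -> measurable B ->
    P ((X1 @^-1` A) `&` (X2 @^-1` B)) = P (X1 @^-1` A) * P (X2 @^-1` B)) ->
  (forall A B, measurable A -> measurable B ->
    P ((X1 @^-1` A) `&` (X2 @^-1` B) `&` D) = P ((X1 @^-1` A) `&` D) * Q B) ->
  Q setT < +oo -> measurable S2 -> Q (~` S2) = 0 ->
  (forall B, measurable B -> B `<=` S2 -> Q B = 0 -> P (X2 @^-1` B) = 0) ->
  measurable D' -> as_eq P D ((fun w => (X1 w, X2 w)) @^-1` D') ->
  exists2 S1, measurable S1 & as_eq P D ((X1 @^-1` S1) `&` (X2 @^-1` S2)).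
Proof.
move=> mX1 mX2 mD indP indD Qfin mS2 QS2 S2P mD' DD'.
pose X w := (X1 w, X2 w).
have mX : measurable_fun setT X by exact: measurable_fun_pair.
have mpre1 A : measurable A -> measurable (X1 @^-1` A).
  by move=> mA; rewrite -[X in measurable X]setTI; exact: mX1.
have mpre2 A : measurable A -> measurable (X2 @^-1` A).
  by move=> mA; rewrite -[X in measurable X]setTI; exact: mX2.
have mpre A : measurable A -> measurable (X @^-1` A).
  by move=> mA; rewrite -[X in measurable X]setTI; exact: mX.
have PD_lty : mrestr P mD setT < +oo.
  by rewrite /mrestr -ge0_fin_numE//; exact/fin_num_measure/measurableI.
have P_lty : P setT < +oo by rewrite probability_setT ltry.
have [n1 n1E] := exists_pushforward P X1 mX1 P_lty.
have [n2 n2E] := exists_pushforward P X2 mX2 P_lty.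
have [M ME] := exists_pushforward P X mX P_lty.
have [m1 m1E] := exists_pushforward (mrestr P mD) X1 mX1 PD_lty.
have [MD MDE] := exists_pushforward (mrestr P mD) X mX PD_lty.
have [m2 m2E] := exists_finite_measure Q Qfin.
have [S1 [mS1 m1S1 S1n1]] := exists_support m1 n1.
pose C := (S1 `*` S2) `\` D'.
have mC : measurable C by apply: measurableD => //; exact: measurableX.
have MDC : MD C = 0.
  rewrite MDE/= /mrestr; apply: measure_negligible.
    by apply: measurableI => //; exact: mpre.
  apply: negligibleS DD' => w [[_ nD'] Dw]; left; split => //.
have MC : M C = 0.
  have := @product_measure_null R _ _ T1 T2 m1 n1 m2 n2 S1 S2 C mS1 mS2 S1n1.
  (* Both laws of the pair are product measures because they factor on rectangles. *)
  rewrite (product_measure_unique (m' := MD))//; last first.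
    move=> A B mA mB; change (MD (A `*` B) = m1 A * m2 B).
    by rewrite MDE m1E m2E/= /mrestr -indD.
  rewrite (product_measure_unique (m' := M))//; last first.
    move=> A B mA mB; change (M (A `*` B) = n1 A * n2 B).
    by rewrite ME n1E n2E -indP.
  apply => // [B mB BS2|x []//].
  by rewrite m2E n2E; exact: S2P.
exists S1 => //.
have N1 : P.-negligible ((X1 @^-1` (~` S1)) `&` D).
  apply/negligibleP; first by apply: measurableI => //; exact/mpre1/measurableC.
  by rewrite -[RHS]m1S1 m1E.
have N2 : P.-negligible ((X2 @^-1` (~` S2)) `&` D).
  apply/negligibleP; first by apply: measurableI => //; exact/mpre2/measurableC.
  have := indD setT (~` S2) measurableT (measurableC mS2).
  by rewrite preimage_setT !setTI QS2 mule0.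
have NC : P.-negligible (X @^-1` C).
  by apply/negligibleP; [exact: mpre|rewrite -[RHS]MC ME].
apply: negligibleS (negligibleU (negligibleU N1 N2) (negligibleU NC DD')) => w.
move=> [[Dw /not_andP[nS|nS]]|[[S1w S2w] nDw]].
- by left; left; split.
- by left; right; split.
- right; have [D'w|nD'w] := pselect (D' (X w)); last by left; split.
  by right; right; split.
Qed.
End factorization.

(** * Almost sure equality and completed sigma-fields *)

Section as_equality.
Local Open Scope ereal_scope.
Context {d} {Omega : measurableType d} {R : realType} (P : probability Omega R).

Lemma as_eq_sym (A B : set Omega) : as_eq P A B -> as_eq P B A.
Proof. by rewrite /as_eq setUC. Qed.

Lemma as_eq_refl (A : set Omega) : as_eq P A A.
Proof. by rewrite /as_eq setDv setU0; exact: negligible_set0. Qed.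

Lemma as_eq_trans (A B C : set Omega) :
  as_eq P A B -> as_eq P B C -> as_eq P A C.
Proof.
move=> AB BC; apply: negligibleS (negligibleU AB BC) => w.
by have [Bw|nBw] := pselect (B w); move=> [[? ?]|[? ?]];
  [right; left|left; right|left; left|right; right].
Qed.

Lemma as_eqI (A B A' B' : set Omega) :
  as_eq P A B -> as_eq P A' B' -> as_eq P (A `&` A') (B `&` B').
Proof.
move=> AB AB'; apply: negligibleS (negligibleU AB AB') => w.
move=> [[[Aw A'w] /not_andP[]]|[[Bw B'w] /not_andP[]]] nw.
- by left; left.
- by right; left.
- by left; right.
- by right; right.
Qed.

Lemma as_eqC (A B : set Omega) : as_eq P A B -> as_eq P (~` A) (~` B).
Proof. by rewrite /as_eq !setDE !setCK setUC ![~` _ `&` _]setIC. Qed.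

Lemma as_eq_bigcup (A B : nat -> set Omega) :
  (forall n, as_eq P (A n) (B n)) -> as_eq P (\bigcup_n A n) (\bigcup_n B n).
Proof.
move=> AB; apply: negligibleS (negligible_bigcup AB) => w.
move=> [[[n _ Anw] nB]|[[n _ Bnw] nA]]; exists n => //.
  by left; split => // Bnw; apply: nB; exists n.
by right; split => // Anw; apply: nA; exists n.
Qed.

Lemma as_eq_measure (A B : set Omega) : measurable A -> measurable B ->
  as_eq P A B -> P A = P B.
Proof.
move=> mA mB AB.
have h C C' : measurable C -> measurable C' -> as_eq P C C' -> P C <= P C'.
  move=> mC mC' CC'.
  rewrite -(setUIDK C C')measureU//; last 3 first.
  - exact: measurableI.
  - exact: measurableD.
  - by apply/seteqP; split => // w [[_ +] [_ +]].
  rewrite [X in _ + X](_ : _ = 0) ?adde0.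
    by rewrite le_measure ?inE//; exact: measurableI.
  apply: measure_negligible; first exact: measurableD.
  by apply: negligibleS CC' => w; left.
by apply/eqP; rewrite eq_le !h//; exact: as_eq_sym.
Qed.

(** The measurable sets that are a.s. equal to a member of [H] form a sigma-field containing [H] and
    the null sets. *)
Lemma completion_as_eq (H : set (set Omega)) (A : set Omega) :
  sigma_algebra setT H -> H `<=` measurable -> completion P H A ->
  measurable A /\ exists2 B, H B & as_eq P A B.
Proof.
move=> [H0 HC HU] Hm.
apply: (smallest_sub (C := sigma_algebra setT)
  (X := [set A | measurable A /\ exists2 B, H B & as_eq P A B])).
  split.
  - by split => //; exists set0 => //; exact: as_eq_refl.
  - move=> X [mX [B HB XB]]; split; first exact: measurableD.
    by exists (setT `\` B); [exact: HC|rewrite !setTD; exact: as_eqC].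
  - move=> X HX; split.
      by apply: bigcupT_measurable => k; case: (HX k).
    have /choice[B HB] : forall k, exists B, H B /\ as_eq P (X k) B.
      by move=> k; have [_ [B ? ?]] := HX k; exists B.
    exists (\bigcup_k B k); first by apply: HU => k; case: (HB k).
    by apply: as_eq_bigcup => k; case: (HB k).
move=> X [HX|[mX X0]].
  by split; [exact: Hm|exists X => //; exact: as_eq_refl].
split => //; exists set0 => //.
by rewrite /as_eq setD0 set0D setU0; exact/negligibleP.
Qed.

Lemma as_eq_completion (H : set (set Omega)) (A B : set Omega) :
  measurable A -> measurable B -> H B -> as_eq P A B -> completion P H A.
Proof.
move=> mA mB HB AB.
have [s0 sD sU] : sigma_algebra setT (completion P H) by exact: smallest_sigma_algebra.
have null X : measurable X -> P.-negligible X -> completion P H X.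
  move=> mX NX; apply: sub_sigma_algebra; right; split => //.
  exact/negligibleP.
have cC X : completion P H X -> completion P H (~` X).
  by move=> /sD; rewrite setTD.
have cU X X' : completion P H X -> completion P H X' -> completion P H (X `|` X').
  by move=> cX cX'; rewrite -bigcup2E; apply: sU => -[|[|n]].
(* [A] is the union of A \ B and B \ (B \ A), the latter written with complements and unions
   only. *)
have -> : A = (A `\` B) `|` ~` (~` B `|` (B `\` A)).
  apply/seteqP; split => [w Aw|w [[]//|]].
    have [Bw|nBw] := pselect (B w); last by left.
    by right => -[//|[]].
  by move=> /not_orP[/contrapT Bw nn]; apply: contrapT => nAw; apply: nn.
apply: (cU _ _ _ (cC _ (cU _ _ (cC _ _) _))).
- by apply: null; [exact: measurableD|apply: negligibleS AB => w; left].
- by apply: sub_sigma_algebra; left.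
- by apply: null; [exact: measurableD|apply: negligibleS AB => w; right].
Qed.

Lemma completionS (H H' : set (set Omega)) :
  H `<=` H' -> completion P H `<=` completion P H'.
Proof. by move=> HH'; apply: sub_sigma_algebra2; exact: setSU. Qed.

End as_equality.

(** * Cylinders as a generating pi-system *)

Section cylinders.
Context {dE} {E : measurableType dE}.

(* [prod_sigma E] is convertible to the measurable sets of
   [g_sigma_algebraType coordinate_sets]. *)
Definition coordinate_sets : set (set (nat -> E)) :=
  \bigcup_(i in [set: nat])
    preimage_set_system setT (fun s : nat -> E => s i) measurable.

Definition cylinder (k : nat) (B : nat -> set E) : set (nat -> E) :=
  [set s | forall i, (i < k)%N -> B i (s i)].

Definition cylinders : set (set (nat -> E)) :=
  [set S | exists k B, (forall i, measurable (B i)) /\ S = cylinder k B].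

Lemma cylindersI : setI_closed cylinders.
Proof.
move=> _ _ [k [B [mB ->]]] [l [C [mC ->]]].
(* Padding with the whole space brings both cylinders to length [maxn k l]. *)
pose up k (B : nat -> set E) i := if (i < k)%N then B i else setT.
exists (maxn k l), (fun i => up k B i `&` up l C i); split.
  by move=> i; apply: measurableI; rewrite /up; case: ifP.
apply/seteqP; split => [s [sB sC] i _|s sBC].
  by split; rewrite /up; case: ifP => // ?; [exact: sB|exact: sC].
split => i ik.
  by have [] : (up k B i `&` up l C i) (s i);
    [apply: sBC; rewrite leq_max ik|rewrite {1}/up ik].
by have [_] : (up k B i `&` up l C i) (s i);
  [apply: sBC; rewrite leq_max ik orbT|rewrite {1}/up ik].
Qed.

Lemma cylinder_measurable k (B : nat -> set E) :
  (forall i, measurable (B i)) -> prod_sigma E (cylinder k B).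
Proof.
move=> mB.
rewrite -[cylinder k B]setCK; apply: (@sigma_algebraC (nat -> E)).
rewrite (_ : ~` _ = \bigcup_i (if (i < k)%N then ~` [set s | B i (s i)] else set0)).
  apply: sigma_algebra_bigcup => i; case: ifP => _; last exact: sigma_algebra0.
  apply: (@sigma_algebraC (nat -> E)); apply: sub_sigma_algebra.
  by exists i => //; exists (B i) => //; rewrite setTI.
apply/seteqP; split => [s /existsNP[i /not_implyP[ik nB]]|s [i _]].
  by exists i => //; rewrite ik.
by case: ifP => // ik nB /(_ i ik).
Qed.

Lemma coordinate_sets_cylinders : coordinate_sets `<=` cylinders.
Proof.
move=> _ [i _ [B mB <-]]; rewrite setTI.
exists i.+1, (fun j => if j == i then B else setT); split.
  by move=> j; case: ifP.
apply/seteqP; split => [s Bs j _|s /(_ i (ltnSn i))]; last by rewrite eqxx.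
by case: eqP => [->|].
Qed.

End cylinders.

(** * Independence of the past and the shifted sequence *)

Section shifted_sequence.
Local Open Scope ereal_scope.
Context {d} {Omega : measurableType d} {R : realType} (P : probability Omega R)
  (F : nat -> set (set Omega)) {dE} {E : measurableType dE}
  (Y : nat -> Omega -> E).
Hypothesis filtF : filtration F.
Hypothesis adY : forall n B, (1 <= n)%N -> measurable B -> F n (Y n @^-1` B).
Hypothesis indY : forall i A B, F i A -> measurable B ->
  P (A `&` (Y i.+1 @^-1` B)) = P A * P (Y i.+1 @^-1` B).
Hypothesis idY : forall i B, measurable B ->
  P (Y i.+1 @^-1` B) = P (Y 1%N @^-1` B).

Lemma filtration_measurable n A : F n A -> measurable A.
Proof. by have [_ [Fm _]] := filtF; exact: Fm. Qed.

Lemma filtrationT n : F n setT.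
Proof. by have [/(_ n)[F0 /(_ _ F0)]] := filtF; rewrite setD0. Qed.

Lemma filtrationC n A : F n A -> F n (~` A).
Proof. by have [/(_ n)[_ FC _] _] := filtF; move=> /FC; rewrite setTD. Qed.

Lemma filtration_bigcup n (A : nat -> set Omega) :
  (forall k, F n (A k)) -> F n (\bigcup_k A k).
Proof. by have [/(_ n)[_ _ FU] _] := filtF; exact: FU. Qed.

Lemma filtrationU n A B : F n A -> F n B -> F n (A `|` B).
Proof.
move=> FA FB; rewrite -bigcup2E; apply: filtration_bigcup => -[|[|k]] //=.
by rewrite /bigcup2/= -setCT; apply/filtrationC/filtrationT.
Qed.

Lemma filtrationI n A B : F n A -> F n B -> F n (A `&` B).
Proof.
move=> FA FB; rewrite -[A `&` B]setCK setCI; apply: filtrationC.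
by apply: filtrationU; exact: filtrationC.
Qed.

(** Coordinate [k] of the sequence shifted by [n] is [Y] at index n + k + 1, which is independent of
    [F (n + k)]. *)
Lemma Box_cylinderS n k (B : nat -> set E) :
  Box Y n @^-1` cylinder k.+1 B =
  (Box Y n @^-1` cylinder k B) `&` (Y (n + k).+1 @^-1` B k).
Proof.
apply/seteqP; split => [w wB|w [wB wk] i].
  split; first by move=> i ik; apply: wB; exact: ltnW.
  by rewrite /= -addnS; exact: wB.
rewrite ltnS leq_eqVlt => /predU1P[->|]; last exact: wB.
by rewrite /Box addnS.
Qed.

Lemma cylinder_filtration n k (B : nat -> set E) :
  (forall i, measurable (B i)) -> F (n + k) (Box Y n @^-1` cylinder k B).
Proof.
move=> mB; elim: k => [|k IH].
  by rewrite (_ : _ @^-1` _ = setT); [exact: filtrationT|exact/seteqP].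
have [_ [_ incF]] := filtF.
rewrite Box_cylinderS addnS; apply: filtrationI; last exact: adY.
by apply: incF IH.
Qed.

(** Induction on [k]: [A] and the event on the first [k] coordinates are in [F (n + k)], so the next
    coordinate splits off as a factor, which by identical distribution does not depend on [n]. *)
Lemma independent_cylinder n k A (B : nat -> set E) : F n A ->
  (forall i, measurable (B i)) ->
  P (A `&` (Box Y n @^-1` cylinder k B)) =
    P A * \prod_(i < k) P (Y 1%N @^-1` B i).
Proof.
move=> FA mB; elim: k => [|k IH].
  by rewrite big_ord0 mule1 (_ : _ @^-1` _ = setT) ?setIT//; exact/seteqP.
have [_ [_ incF]] := filtF.
rewrite Box_cylinderS setIA indY//; last first.
  by apply: filtrationI; [exact: incF (leq_addr _ _) _ FA|exact: cylinder_filtration].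
by rewrite IH idY// big_ord_recr/= muleA.
Qed.

Lemma Box_measurable n S : prod_sigma E S -> measurable (Box Y n @^-1` S).
Proof.
apply: (smallest_sub (C := sigma_algebra setT)
  (X := [set S | measurable (Box Y n @^-1` S)])).
  split => [|A mA|A mA].
  - by rewrite /= preimage_set0.
  - by rewrite /= setTD preimage_setC; exact: measurableC.
  - by rewrite /= preimage_bigcup; exact: bigcupT_measurable.
move=> _ [i _ [B mB <-]]; rewrite /= setTI.
by apply: (filtration_measurable (n + i.+1)); apply: (adY (n + i.+1)) => //; rewrite addnS.
Qed.

Lemma Box_measurable_fun n :
  measurable_fun setT (Box Y n : Omega -> g_sigma_algebraType (@coordinate_sets _ E)).
Proof. by move=> _ B mB; rewrite setTI; exact: Box_measurable. Qed.

(** Both sides are finite measures in [S] that agree on cylinders, hence everywhere. [Box Y 0] is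
    the sequence itself; [A := setT] shows that every [Box Y n] has its law. *)
Lemma independent_Box n A S : F n A -> prod_sigma E S ->
  P (A `&` (Box Y n @^-1` S)) = P A * P (Box Y 0 @^-1` S).
Proof.
move=> FA mS; have mA := filtration_measurable _ _ FA.
have P_lty : P setT < +oo by rewrite probability_setT ltry.
have PA_lty : mrestr P mA setT < +oo.
  by rewrite /mrestr -ge0_fin_numE//; exact/fin_num_measure/measurableI.
have [nu nuE] := exists_pushforward (mrestr P mA) _ (Box_measurable_fun n) PA_lty.
have [L LE] := exists_pushforward P _ (Box_measurable_fun 0) P_lty.
(* [mscale] takes a nonnegative real factor, so [P A] passes through [fine]. *)
have PA : P A = (fine (P A))%:E by rewrite fineK// fin_num_measure.
have PA0 : (0 <= fine (P A))%R by rewrite fine_ge0.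
pose cL : {measure set _ -> \bar R} := mscale (NngNum PA0) L.
suff : nu S = cL S by rewrite /cL /= /mscale/= nuE LE /mrestr/= -PA setIC.
have cylT : cylinders (@setT (nat -> E)).
  exists 0%N, (fun=> setT); split => //; apply/seteqP; split => //.
have nu_cL C : cylinders C -> nu C = cL C.
  move=> [k [B [mB ->]]]; rewrite /cL /= /mscale/= nuE LE/= /mrestr setIC -PA.
  rewrite independent_cylinder//; congr (_ * _).
  (* The cylinder formula at time 0 for the whole space identifies the product of marginals as a
     value of [L]. *)
  have := independent_cylinder 0 k setT B (filtrationT 0) mB.
  by rewrite setTI probability_setT mul1e.
have cyl_meas : cylinders `<=`
    @measurable _ (g_sigma_algebraType (@coordinate_sets _ E)).
  by move=> _ [k [B [mB ->]]]; exact: cylinder_measurable.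
have cover : \bigcup_(k in [set: nat]) (fun=> setT) k = @setT (nat -> E).
  by rewrite bigcup_const.
have uniq := @g_sigma_algebra_measure_unique _ R
  (g_sigma_algebraType (@coordinate_sets _ E)) _ cyl_meas (fun=> setT)
  (fun=> cylT) cover nu cL cylindersI nu_cL.
apply: uniq.
- by move=> _; rewrite -ge0_fin_numE ?fin_num_measure.
- by apply: sub_sigma_algebra2 mS; exact: coordinate_sets_cylinders.
Qed.

(** * The random time and its sigma-field of prior events *)

Variable T : Omega -> option nat.
Hypothesis mReq : forall n, measurable (Req T n).

Lemma RfinE : Rfin T = \bigcup_n Req T n.
Proof.
apply/seteqP; split => [w|w [n _]]; rewrite /Rfin /Req /=; last by move=> ->.
by case Tw: (T w) => [n|] // _; exists n.
Qed.

Lemma Rfin_measurable : measurable (Rfin T).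
Proof. by rewrite RfinE; exact: bigcupT_measurable. Qed.

Lemma trivIset_Req A : trivIset setT (fun n => A `&` Req T n).
Proof.
by apply/trivIsetP => i j _ _; apply: contra_neqP => /eqP/set0P[w [[_ +] [_]]];
  rewrite /Req/= => -> [].
Qed.

Lemma BoxR_Req n B : (BoxR Y T @^-1` B) `&` Req T n = (Box Y n @^-1` B) `&` Req T n.
Proof.
by apply/seteqP; split => w [+ Tw]; rewrite /BoxR/=; move: (Tw); rewrite /Req/= => ->.
Qed.

Lemma BoxR_measurable B : prod_sigma E B -> measurable (BoxR Y T @^-1` B).
Proof.
move=> mB.
(* Where the time is infinite, [BoxR] falls back on shift 0; hence the extra last piece. *)
rewrite (_ : _ @^-1` _ = \bigcup_n ((Box Y n @^-1` B) `&` Req T n) `|`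
    ((Box Y 0 @^-1` B) `&` ~` Rfin T)).
  apply: measurableU; first apply: bigcupT_measurable => n.
    by apply: measurableI => //; exact: Box_measurable.
  by apply: measurableI; [exact: Box_measurable|exact/measurableC/Rfin_measurable].
apply/seteqP; split => [w Bw|w [[n _]|]].
- have [[n Tn]|Tw] : (exists n, T w = Some n) \/ T w = None.
    by case: (T w) => [n|]; [left; exists n|right].
    by left; exists n => //; rewrite -BoxR_Req.
  right; split; last by rewrite /Rfin/= Tw.
  by move: Bw; rewrite /BoxR/= Tw.
- by rewrite -BoxR_Req => -[].
- by move=> [+ /contrapT Tw]; rewrite /BoxR/= Tw.
Qed.

Lemma measure_Rfin A : measurable A ->
  P (A `&` Rfin T) = \sum_(n <oo) P (A `&` Req T n).
Proof.
move=> mA; rewrite RfinE setI_bigcupr measure_bigcup//.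
- by rewrite (eq_eseriesl (Q := xpredT))// => n; rewrite in_setT.
- by move=> n _; exact: measurableI.
- exact: trivIset_Req.
Qed.

(** On [Req T n] an adapted process taken at the random time is [Z n], so the generators have the
    property, and the sets with the property form a sigma-field on [Rfin T]. *)
Lemma F_R'_trace A : F_R' (R := R) F T A -> A `<=` Rfin T /\
  forall n, exists2 B, F n B & A `&` Req T n = B `&` Req T n.
Proof.
apply: (smallest_sub (C := sigma_algebra (Rfin T)) (X := [set A | A `<=` Rfin T /\
  forall n, exists2 B, F n B & A `&` Req T n = B `&` Req T n])).
  split => [|X [XT XF]|X HX].
  - split; first exact: sub0set.
    by move=> n; exists set0 => //; have [/(_ n)[]] := filtF.
  - split => [w []//|n]; have [B FB XB] := XF n.
    exists (~` B); first exact: filtrationC.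
    apply/seteqP; split => [w [[_ nX] Tw]|w [nB Tw]]; split => //.
      by move=> Bw; apply: nX; have [] : (X `&` Req T n) w by rewrite XB.
    split; first by rewrite RfinE; exists n.
    by move=> Xw; apply: nB; have [] : (B `&` Req T n) w by rewrite -XB.
  - split => [|n]; first by apply: bigcup_sub => k _; case: (HX k).
    have /choice[B HB] : forall k, exists B, F n B /\ X k `&` Req T n = B `&` Req T n.
      by move=> k; have [_ /(_ n)[B ? ?]] := HX k; exists B.
    exists (\bigcup_k B k); first by apply: filtration_bigcup => k; case: (HB k).
    by rewrite !setI_bigcupl; apply: eq_bigcupr => k _; case: (HB k).
move=> _ [Z adZ [B mB <-]]; split => [w []//|n].
exists (Z n @^-1` B); first exact: adZ.
apply/seteqP; split => [w [[_ +] Tw]|w [ZB Tw]].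
  by move: (Tw); rewrite /Req/= => ->.
split => //; split; first by rewrite RfinE; exists n.
by move: (Tw); rewrite /Req/= => ->.
Qed.

(** The adapted process [Z] that is the indicator of [A] at time [n] and zero at all other times
    takes the value 1 at the random time exactly on this set. *)
Lemma F_R'_Req n A : F n A -> F_R' (R := R) F T (A `&` Req T n).
Proof.
move=> FA; apply: sub_sigma_algebra.
pose Z k w : R := if k == n then \1_A w else 0%R.
exists Z.
  move=> k B mB; rewrite /Z; case: eqP => [->|_].
    have F0 : F n set0 by have [/(_ n)[]] := filtF.
    rewrite preimage_indic; do 2 case: ifP => _ //.
    - exact: filtrationT.
    - exact: filtrationC.
  rewrite preimage_cst; case: ifP => _; first exact: filtrationT.
  by have [/(_ k)[]] := filtF.
exists [set 1%R]; first exact: measurable_set1.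
rewrite /Z; apply/seteqP; split => [w [Tw]|w [Aw Tw]] /=.
  have [m Tm] : exists m, T w = Some m.
    by move: Tw; rewrite /Rfin/=; case: (T w) => // m; exists m.
  rewrite Tm/=; case: eqP => [mn|_ /eqP]; last by rewrite eq_sym oner_eq0.
  rewrite indicE; have [Aw _|] := boolP (w \in A); last by move=> _ /eqP; rewrite eq_sym oner_eq0.
  by split; [exact: set_mem|rewrite /Req/= Tm mn].
split; first by rewrite RfinE; exists n.
by move: (Tw); rewrite /Req/= => ->; rewrite /= eqxx indicE mem_set.
Qed.

Lemma F_R'_measurable A : F_R' (R := R) F T A -> measurable A.
Proof.
move=> /F_R'_trace[AT AF].
rewrite -(setIidl AT) RfinE setI_bigcupr; apply: bigcupT_measurable => n.
have [B FB ->] := AF n.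
by apply: measurableI => //; exact: filtration_measurable FB.
Qed.

(** * Consequences of (b): independence and the law of the shifted sequence *)

Lemma prod_sigmaI (A B : set (nat -> E)) :
  prod_sigma E A -> prod_sigma E B -> prod_sigma E (A `&` B).
Proof. exact: (@measurableI _ (g_sigma_algebraType (@coordinate_sets _ E))). Qed.

Lemma prod_sigmaC (A : set (nat -> E)) : prod_sigma E A -> prod_sigma E (~` A).
Proof. exact: (@measurableC _ (g_sigma_algebraType (@coordinate_sets _ E))). Qed.

Lemma prod_sigmaT : prod_sigma E setT.
Proof. exact: (@measurableT _ (g_sigma_algebraType (@coordinate_sets _ E))). Qed.

Lemma F_R'T : F_R' (R := R) F T (Rfin T).
Proof.
have [F0 FD _] : sigma_algebra (Rfin T) (F_R' (R := R) F T).
  exact: smallest_sigma_algebra.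
by have := FD _ F0; rewrite setD0.
Qed.

(** On [Req T n] the event is a.s. a member of [F n] intersected with [Box Y n] lying in both [G]
    and [B], and [independent_Box] factors its probability. Summing over [n] yields a constant that
    does not depend on [B], the source of the independence. *)
Lemma measure_b_witness G Fs A : b_witness P F Y T G Fs ->
  F_R' (R := R) F T A ->
  exists2 c, 0 <= c & forall B, prod_sigma E B ->
    P (A `&` (BoxR Y T @^-1` B) `&` Rfin T) = c * P (Box Y 0 @^-1` (G `&` B)).
Proof.
move=> [mG bw] FA; have mA := F_R'_measurable _ FA.
have [AT] := F_R'_trace _ FA.
move=> /(_ _)/cid2 - /all_sig2[An FAn AAn].
(* (b) says nothing about [Fs n] when [Req T n] has probability zero, so these terms are set to
   0. *)
pose a n := if 0 < P (Req T n) then P (An n `&` Fs n) else 0.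
have a0 n : 0 <= a n by rewrite /a; case: ifP.
exists (\sum_(n <oo) a n); first by apply: nneseries_ge0 => n _ _.
move=> B mB; have mGB := prod_sigmaI _ _ mG mB.
have LfinE : (fine (P (Box Y 0 @^-1` (G `&` B))))%:E = P (Box Y 0 @^-1` (G `&` B)).
  by rewrite fineK//; apply: fin_num_measure; exact: Box_measurable.
rewrite measure_Rfin; last by apply: measurableI => //; exact: BoxR_measurable.
rewrite -LfinE muleC -nneseriesZl; last by move=> n _.
apply: eq_eseriesr => n _; rewrite LfinE muleC /a; case: ifPn => Rn0; last first.
  rewrite mul0e; apply/eqP; rewrite -measure_le0; apply: le_trans (_ : P (Req T n) <= 0).
    by rewrite le_measure ?inE//; apply: measurableI => //; apply: measurableI => //;
      exact: BoxR_measurable.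
  by rewrite leNgt.
have [FFs RFs] := bw n Rn0.
have FAFs : F n (An n `&` Fs n) by exact: filtrationI.
rewrite -(independent_Box n)//.
rewrite -[_ `&` _ `&` Req T n]setIA BoxR_Req setICA AAn.
apply: as_eq_measure.
- apply: measurableI; first exact: Box_measurable.
  by apply: measurableI => //; exact: filtration_measurable (FAn n).
- by apply: measurableI; [exact: filtration_measurable FAFs|exact: Box_measurable].
rewrite preimage_setI (_ : _ `&` _ `&` _ =
    (Box Y n @^-1` B) `&` (An n `&` (Fs n `&` (Box Y n @^-1` G)))).
  apply: as_eqI; first exact: as_eq_refl.
  by apply: as_eqI; first exact: as_eq_refl.
by rewrite [RHS]setIC !setIA.
Qed.

Hypothesis Rfin0 : 0 < P (Rfin T).

(** Were [G] null, [A := Rfin T] and [B := setT] would give [Rfin T] probability zero. As [G] has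
    positive mass, the constant is finite and real arithmetic applies. *)
Lemma fine_measure_b_witness G Fs : b_witness P F Y T G Fs ->
  0 < P (Box Y 0 @^-1` G) /\
  forall A, F_R' (R := R) F T A -> exists c : R, forall B, prod_sigma E B ->
    fine (P (A `&` (BoxR Y T @^-1` B) `&` Rfin T)) =
      (c * fine (P (Box Y 0 @^-1` (G `&` B))))%R.
Proof.
move=> bw; have [mG _] := bw.
have LG0 : 0 < P (Box Y 0 @^-1` G).
  rewrite lt0e measure_ge0 andbT; apply/eqP => LG0.
  have [c _ /(_ _ prod_sigmaT)] : exists2 c, 0 <= c & forall B, prod_sigma E B ->
    P (Rfin T `&` (BoxR Y T @^-1` B) `&` Rfin T) = c * P (Box Y 0 @^-1` (G `&` B)).
    exact: measure_b_witness bw F_R'T.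
  rewrite preimage_setT !setIT setIid LG0 mule0 => RT0.
  by move: Rfin0; rewrite RT0 ltxx.
split => // A FA; have [c c0 cE] := measure_b_witness _ _ _ bw FA.
have cfin : c \is a fin_num.
  rewrite ge0_fin_numE// ltNge leye_eq; apply/negP => /eqP coo.
  have := cE _ prod_sigmaT; rewrite setIT coo gt0_mulye// preimage_setT setIT => Aoo.
  have : P (A `&` Rfin T) \is a fin_num.
    apply: fin_num_measure; apply: measurableI; last exact: Rfin_measurable.
    exact: F_R'_measurable.
  by rewrite Aoo.
exists (fine c) => B mB; rewrite cE// fineM//.
by apply: fin_num_measure; apply: Box_measurable; exact: prod_sigmaI.
Qed.

(** With [A := Rfin T], numerator and denominator carry the same constant [c], which cancels. *)
Lemma law_b_witness G Fs B : b_witness P F Y T G Fs -> prod_sigma E B ->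
  condP P (Rfin T) (BoxR Y T @^-1` B) =
  (fine (P (Box Y 0 @^-1` (B `&` G))) / fine (P (Box Y 0 @^-1` G)))%R.
Proof.
move=> bw mB; have [mG _] := bw.
have [LG0 /(_ _ F_R'T)[c cE]] := fine_measure_b_witness _ _ bw.
have := cE _ prod_sigmaT; rewrite preimage_setT !setIT setIid => RfinE'.
have RT0 : (fine (P (Rfin T)) != 0)%R.
  rewrite gt_eqF// fine_gt0// Rfin0/= -ge0_fin_numE//.
  exact/fin_num_measure/Rfin_measurable.
have cG0 : (c * fine (P (Box Y 0 @^-1` G)) != 0)%R by rewrite -RfinE'.
have c0 : (c != 0)%R by apply: contra_neq cG0 => ->; rewrite mul0r.
have XE : (BoxR Y T @^-1` B) `&` Rfin T =
    Rfin T `&` (BoxR Y T @^-1` B) `&` Rfin T by rewrite setIAC setIid setIC.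
by rewrite /condP RfinE' XE cE// [B `&` G]setIC -mulf_div divff// mul1r.
Qed.

(** With constants [a] for [A] and [c] for [Rfin T], both sides equal a/c times the conditional
    probability of [B] given [G] under the law of the sequence. *)
Lemma b_witness_independent G Fs : b_witness P F Y T G Fs -> stmt_a P F Y T.
Proof.
move=> bw A _ FA [B mB <-]; have [mG _] := bw.
have [LG0 ex] := fine_measure_b_witness _ _ bw.
have [c cE] := ex _ F_R'T; have [a aE] := ex _ FA.
have := cE _ prod_sigmaT; rewrite preimage_setT !setIT setIid => RfinE'.
have := aE _ prod_sigmaT; rewrite preimage_setT !setIT => AE.
have RT0 : (fine (P (Rfin T)) != 0)%R.
  rewrite gt_eqF// fine_gt0// Rfin0/= -ge0_fin_numE//.
  exact/fin_num_measure/Rfin_measurable.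
have cG0 : (c * fine (P (Box Y 0 @^-1` G)) != 0)%R by rewrite -RfinE'.
have c0 : (c != 0)%R by apply: contra_neq cG0 => ->; rewrite mul0r.
have G0 : (fine (P (Box Y 0 @^-1` G)) != 0)%R.
  by apply: contra_neq cG0 => ->; rewrite mulr0.
have BE : fine (P (Rfin T `&` (BoxR Y T @^-1` B) `&` Rfin T)) =
    (c * fine (P (Box Y 0 @^-1` (G `&` B))))%R by exact: cE.
rewrite /condP BE AE RfinE'.
rewrite (_ : _ `&` _ `&` Rfin T = A `&` (BoxR Y T @^-1` B) `&` Rfin T); last first.
  by apply/seteqP; split => w; [move=> [[? [? ?]] ?]|move=> [[? ?] ?]].
rewrite aE//; field.
by rewrite c0 G0.
Qed.

(** * Uniqueness of the witnesses of (b) *)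

Lemma b_witness_unique_half n A A' G G' : F n A -> F n A' ->
  prod_sigma E G -> prod_sigma E G' ->
  as_eq P (A `&` (Box Y n @^-1` G)) (A' `&` (Box Y n @^-1` G')) ->
  0 < P (A `&` (Box Y n @^-1` G)) ->
  P (A `\` A') = 0 /\ P (Box Y 0 @^-1` (G `\` G')) = 0.
Proof.
move=> FA FA' mG mG' AA'; rewrite (independent_Box n)// => AG0.
have PA0 : P A != 0 by apply: contraTneq AG0 => ->; rewrite mul0e ltxx.
have LG0 : P (Box Y 0 @^-1` G) != 0.
  by apply: contraTneq AG0 => ->; rewrite mule0 ltxx.
have FD : F n (A `\` A') by rewrite setDE; apply: filtrationI => //; exact: filtrationC.
have mGD : prod_sigma E (G `\` G').
  by rewrite setDE; apply: prod_sigmaI => //; exact: prod_sigmaC.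
(* Replacing one factor by its difference set gives an event inside the null symmetric difference;
   independence writes its probability as a product whose other factor is nonzero. *)
split; apply/eqP.
  suff : P ((A `\` A') `&` (Box Y n @^-1` G)) == 0.
    by rewrite (independent_Box n)// mule_eq0 (negbTE LG0) orbF.
  apply/eqP/measure_negligible.
    apply: measurableI; last exact: Box_measurable.
    exact: filtration_measurable FD.
  by apply: negligibleS AA' => w [[Aw nA'] Gw]; left; split => // -[].
suff : P (A `&` (Box Y n @^-1` (G `\` G'))) == 0.
  by rewrite (independent_Box n)// mule_eq0 (negbTE PA0).
apply/eqP/measure_negligible.
  apply: measurableI; last exact: Box_measurable.
  exact: filtration_measurable FA.
by apply: negligibleS AA' => w [Aw [Gw nG']]; left; split => // -[].
Qed.

Lemma b_witness_unique G Fs G' Fs' :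
  b_witness P F Y T G Fs -> b_witness P F Y T G' Fs' ->
  P (Box Y 0 @^-1` ((G `\` G') `|` (G' `\` G))) = 0 /\
  forall n, 0 < P (Req T n) -> as_eq P (Fs n) (Fs' n).
Proof.
move=> [mG bw] [mG' bw'].
have mE n : 0 < P (Req T n) ->
    [/\ P (Fs n `\` Fs' n) = 0, P (Fs' n `\` Fs n) = 0,
        P (Box Y 0 @^-1` (G `\` G')) = 0 & P (Box Y 0 @^-1` (G' `\` G)) = 0].
  move=> Rn0; have [FF RF] := bw n Rn0; have [FF' RF'] := bw' n Rn0.
  have FsFs' := as_eq_trans _ _ _ _ (as_eq_sym _ _ _ RF) RF'.
  have mFs : measurable (Fs n `&` (Box Y n @^-1` G)).
    apply: measurableI; last exact: Box_measurable.
    exact: filtration_measurable FF.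
  have mFs' : measurable (Fs' n `&` (Box Y n @^-1` G')).
    apply: measurableI; last exact: Box_measurable.
    exact: filtration_measurable FF'.
  have [||] := b_witness_unique_half n _ _ _ _ FF FF' mG mG' => //.
    by rewrite -(as_eq_measure _ _ _ (mReq n) mFs RF).
  move=> ? ?.
  have [||] := b_witness_unique_half n _ _ _ _ FF' FF mG' mG => //.
    exact: as_eq_sym.
  by rewrite -(as_eq_measure _ _ _ (mReq n) mFs' RF').
split => [|n Rn0].
  (* A single [n] of positive probability, which exists because [Rfin T] is not null, already
     determines [G]. *)
  have [n Rn0] : exists n, 0 < P (Req T n).
    apply/not_existsP => Rn; move: Rfin0; rewrite -[Rfin T]setTI measure_Rfin//.
    rewrite eseries0 ?ltxx// => n _ _.
    by apply/eqP; rewrite -measure_le0 setTI leNgt; apply/negP/Rn.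
  have [_ _ GG' G'G] := mE n Rn0.
  have mD B B' : prod_sigma E B -> prod_sigma E B' ->
      measurable (Box Y 0 @^-1` (B `\` B')).
    move=> mB mB'; apply: Box_measurable; rewrite setDE.
    by apply: prod_sigmaI => //; exact: prod_sigmaC.
  by rewrite preimage_setU measureU0//; exact: mD.
have [FF' F'F _ _] := mE n Rn0.
have [FF _] := bw n Rn0; have [FF'n _] := bw' n Rn0.
have mFs := filtration_measurable _ _ FF.
have mFs' := filtration_measurable _ _ FF'n.
by apply: negligibleU; apply/negligibleP => //; exact: measurableD.
Qed.

(** * From (a) to (b) *)

Lemma join_preimage n C :
  join (F n) (sigma_of setT (prod_sigma E) (Box Y n)) C ->
  exists2 D : set (g_sigma_algebraType (F n) *
                   g_sigma_algebraType (@coordinate_sets _ E)),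
    measurable D & C = (fun w => (w, Box Y n w)) @^-1` D.
Proof.
(* The first factor is [Omega] with the sigma-field [F n], so joint events become pullbacks of
   product-measurable sets, as [as_eq_rectangle] asks. *)
set psi := fun w : Omega => (w, Box Y n w).
pose M := @measurable _ (g_sigma_algebraType (F n) *
                   g_sigma_algebraType (@coordinate_sets _ E))%type.
have sM : sigma_algebra setT (preimage_set_system setT psi M).
  exact/sigma_algebra_preimage/sigma_algebra_measurable.
move=> jC; suff : preimage_set_system setT psi M C.
  by move=> [D mD <-]; exists D => //; rewrite setTI.
move: C jC; apply: smallest_sub => // C [FC|[B mB <-]].
  exists (C `*` setT); last by rewrite setTI; apply/seteqP; split => w // [].
  by apply: measurableX => //; exact: sub_sigma_algebra.
exists (setT `*` B); first exact: measurableX.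
by rewrite !setTI; apply/seteqP; split => w // [].
Qed.

Lemma join_measurable n :
  join (F n) (sigma_of setT (prod_sigma E) (Box Y n)) `<=` measurable.
Proof.
apply: smallest_sub; first exact: sigma_algebra_measurable.
move=> A [/filtration_measurable//|[B mB <-]].
by rewrite setTI; exact: Box_measurable.
Qed.

(** [Q] is the law of [BoxR Y T] given [Rfin T]. The part of [A] in [Req T n] is in [F_R'], and
    there [BoxR Y T] agrees with [Box Y n], so (a) splits the probability with one [Q] for all
    [n]. *)
Lemma stmt_a_measure : stmt_a P F Y T ->
  exists2 Q : {finite_measure set (g_sigma_algebraType (@coordinate_sets _ E)) -> \bar R},
    Q setT < +oo & forall n A B, F n A -> prod_sigma E B ->
      P (A `&` (Box Y n @^-1` B) `&` Req T n) = P (A `&` Req T n) * Q B.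
Proof.
move=> sa.
have PR_lty : mrestr P Rfin_measurable setT < +oo.
  rewrite /mrestr -ge0_fin_numE//.
  by apply: fin_num_measure; apply: measurableI => //; exact: Rfin_measurable.
have mBoxR : measurable_fun setT
    (BoxR Y T : Omega -> g_sigma_algebraType (@coordinate_sets _ E)).
  by move=> _ B mB; rewrite setTI; exact: BoxR_measurable.
have [Q0 Q0E] := exists_pushforward (mrestr P Rfin_measurable) _ mBoxR PR_lty.
have p0 : (0 <= (fine (P (Rfin T)))^-1)%R by rewrite invr_ge0 fine_ge0.
pose Q : {finite_measure set _ -> \bar R} := mscale (NngNum p0) Q0.
exists Q; first by rewrite -ge0_fin_numE//; exact: fin_num_measure.
move=> n A B FA mB.
have mA := filtration_measurable _ _ FA.
have mBR : measurable ((BoxR Y T @^-1` B) `&` Rfin T).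
  by apply: measurableI; [exact: BoxR_measurable|exact: Rfin_measurable].
have mAR : measurable (A `&` Req T n) by exact: measurableI.
have mABR : measurable (A `&` (Box Y n @^-1` B) `&` Req T n).
  by apply: measurableI => //; apply: measurableI => //; exact: Box_measurable.
have RT0 : (fine (P (Rfin T)) != 0)%R.
  rewrite gt_eqF// fine_gt0// Rfin0/= -ge0_fin_numE//.
  exact/fin_num_measure/Rfin_measurable.
have RnT : Req T n `<=` Rfin T by rewrite RfinE; exact: bigcup_sup.
have bB : sigma_of (Rfin T) (prod_sigma E) (BoxR Y T)
    (Rfin T `&` (BoxR Y T @^-1` B)) by exists B.
have := sa _ _ (F_R'_Req _ _ FA) bB.
rewrite /condP.
have -> : A `&` Req T n `&` (Rfin T `&` (BoxR Y T @^-1` B)) `&` Rfin T =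
    A `&` (Box Y n @^-1` B) `&` Req T n.
  rewrite -[RHS]setIA -BoxR_Req.
  apply/seteqP; split => [w [[[? ?] [? ?]] ?]//|w [? [? ?]]].
  by split; [split => //; split => //; exact: RnT|exact: RnT].
have -> : A `&` Req T n `&` Rfin T = A `&` Req T n.
  by apply/seteqP; split => [w []//|w [? ?]]; split => //; exact: RnT.
have -> : Rfin T `&` (BoxR Y T @^-1` B) `&` Rfin T = (BoxR Y T @^-1` B) `&` Rfin T.
  by rewrite setIAC setIid setIC.
move=> h; have {h} : (fine (P (A `&` (Box Y n @^-1` B) `&` Req T n)) =
    fine (P (A `&` Req T n)) * ((fine (P (Rfin T)))^-1 *
      fine (P ((BoxR Y T @^-1` B) `&` Rfin T))))%R.
  by rewrite -[LHS](divfK RT0) h; field.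
move=> h; rewrite -[LHS]fineK ?fin_num_measure// h !EFinM.
rewrite !fineK ?fin_num_measure//; congr (_ * _).
by rewrite /Q/= /mscale/= Q0E.
Qed.

Lemma stmt_a_b_witness :
  (forall n, completion P (join (F n) (sigma_of setT (prod_sigma E) (Box Y n)))
    (Req T n)) ->
  stmt_a P F Y T -> exists G Fs, b_witness P F Y T G Fs.
Proof.
move=> cR sa; have [Q Qfin QE] := stmt_a_measure sa.
have P_lty : P setT < +oo by rewrite probability_setT ltry.
have [L LE] := exists_pushforward P _ (Box_measurable_fun 0) P_lty.
(* [G] is fixed before [n], so it is common to all slices. *)
have [G [mG QG GL]] := exists_support Q L.
exists G.
suff /choice[Fs FsP] : forall n, exists A, 0 < P (Req T n) ->
    F n A /\ as_eq P (Req T n) (A `&` (Box Y n @^-1` G)) by exists Fs; split.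
move=> n.
have [_ [C jC RC]] := completion_as_eq _ _ _ (smallest_sigma_algebra _ _)
  (@join_measurable n) (cR n).
have [D' mD' CE] := join_preimage _ _ jC.
have Fn_sigma : sigma_algebra setT (F n) by case: filtF.
have measF (A : set Omega) :
    @measurable _ (g_sigma_algebraType (F n)) A -> F n A.
  by rewrite measurable_g_measurableTypeE.
(* The identity into [Omega] with the smaller sigma-field [F n] plays the role of [X1]. *)
have mid : measurable_fun setT (idfun : Omega -> g_sigma_algebraType (F n)).
  by move=> _ B /measF FB; rewrite setTI; exact: filtration_measurable FB.
have [A /measF FA RA] : exists2 A, @measurable _ (g_sigma_algebraType (F n)) A &
    as_eq P (Req T n) ((idfun @^-1` A) `&` (Box Y n @^-1` G)).
  apply: (@as_eq_rectangle _ _ _ Omega (g_sigma_algebraType (F n))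
    (g_sigma_algebraType (@coordinate_sets _ E)) R P idfun (Box Y n) (Req T n)
    Q G D' mid (Box_measurable_fun n) (mReq n)) => //.
  - move=> A B /measF FA mB; rewrite (independent_Box n)//.
    congr (_ * _).
    by have := independent_Box n _ _ (filtrationT n) mB; rewrite setTI probability_setT mul1e.
  - by move=> A B /measF FA mB; exact: QE.
  - move=> B mB BG B0; have := independent_Box n _ _ (filtrationT n) mB.
    by rewrite setTI probability_setT mul1e -LE GL//; exact.
  - by rewrite CE in RC.
by exists A.
Qed.

(** * Stopping times *)

Lemma stopping_b_witness : stmt_ii P F T ->
  exists Fs, b_witness P F Y T setT Fs.
Proof.
move=> sT; have [sF [mF incF]] := filtF.
(* With [G := setT], (b) only asks that [Req T n] be a.s. equal to a member of [F n]. *)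
suff /choice[Fs FsP] : forall n, exists A, F n A /\ as_eq P (Req T n) A.
  exists Fs; split => [|n _]; first exact: prod_sigmaT.
  by rewrite preimage_setT setIT.
move=> n.
suff cR : completion P (F n) (Req T n).
  by have [_ [A FA RA]] := completion_as_eq _ _ _ (sF n) (mF n) cR; exists A.
have [_ cD _] : sigma_algebra setT (completion P (F n)) by exact: smallest_sigma_algebra.
(* [Req T 0] is itself a sublevel set of the time; each later slice is the difference of two
   consecutive ones. *)
case: n => [|n] in cD *.
  rewrite (_ : Req T 0 = [set w | exists k, T w = Some k /\ (k <= 0)%N]); first exact: sT.
  apply/seteqP; split => [w Tw|w [k [Tk]]]; first by exists 0%N.
  by rewrite leqn0 => /eqP k0; rewrite /Req/= Tk k0.
pose Rle m := [set w | exists k, T w = Some k /\ (k <= m)%N].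
have -> : Req T n.+1 = Rle n.+1 `\` Rle n.
  apply/seteqP; split => [w Tw|w [[k [Tk kn]] nle]].
    split; first by exists n.+1.
    by move=> [k []]; rewrite (Tw : T w = Some n.+1) => -[<-]; rewrite ltnn.
  rewrite /Req/= Tk; congr Some; apply/eqP; rewrite eqn_leq kn/= ltnNge.
  by apply/negP => kn'; apply: nle; exists k.
have cRn : completion P (F n.+1) (Rle n).
  by apply: completionS (sT n) => A; exact: incF.
rewrite -[_ `\` _]setCK setDE setCI setCK -setTD; apply: (cD).
rewrite -bigcup2E; apply: sigma_algebra_bigcup => -[|[|k]] /=.
- by rewrite /bigcup2/= -setTD; apply: (cD); exact: sT.
- by [].
- exact: sigma_algebra0.
Qed.

(** Given [Rfin T], the sequence [BoxR Y T] lies a.s. in [G]; by (i) it has the law of [Box Y 0], so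
    [G] has full measure for that law and [Req T n] is a.s. [Fs n]. *)
Lemma stmt_i_stopping G Fs : b_witness P F Y T G Fs -> stmt_i P F Y T ->
  stmt_ii P F T.
Proof.
move=> bw [_ lawL]; have [mG bwn] := bw; have mGC := prod_sigmaC _ mG.
have LGC : P (Box Y 0 @^-1` (~` G)) = 0.
  rewrite -[LHS]fineK ?fin_num_measure//; last exact: Box_measurable.
  rewrite -lawL// (law_b_witness _ _ _ bw mGC).
  by rewrite setICl preimage_set0 measure0 mul0r.
have cR n : completion P (F n) (Req T n).
  have [Rn0|Rn0] := ltP 0 (P (Req T n)); last first.
    apply: sub_sigma_algebra; right; split => //.
    by apply/eqP; rewrite -measure_le0.
  have [FF RF] := bwn n Rn0.
  apply: (as_eq_completion P _ _ (Fs n)) => //.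
    exact: filtration_measurable FF.
  apply: as_eq_trans RF _; apply: negligibleU; last first.
    apply: negligibleS (_ : P.-negligible (Box Y n @^-1` (~` G))).
      by move=> w [Fw nFG] Gw; apply: nFG.
    apply/negligibleP; first exact: Box_measurable.
    have := independent_Box n _ _ (filtrationT n) mGC.
    by rewrite setTI probability_setT mul1e LGC.
  apply: negligibleS (negligible_set0 _) => w [[? _]] //.
move=> n; have [_ [_ incF]] := filtF.
rewrite (_ : [set w | _] = \bigcup_k (if (k <= n)%N then Req T k else set0)).
  apply: sigma_algebra_bigcup => k; case: ifP => kn; last exact: sigma_algebra0.
  by apply: completionS (cR k); exact: incF.
apply/seteqP; split => [w [k [Tk kn]]|w [k _]].
  by exists k => //; rewrite kn.
by case: ifP => // kn Tk; exists k.
Qed.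

End shifted_sequence.

Theorem theorem2p2 (d : measure_display) (Omega : measurableType d) (R : realType)
  (P : probability Omega R) (F : nat -> set (set Omega))
  (dE : measure_display) (E : measurableType dE) (Y : nat -> Omega -> E)
  (T : Omega -> option nat) :
  filtration F ->
  (* Y adapted: sigma(Y_n) c F_n for n >= 1 *)
  (forall n B, (1 <= n)%N -> measurable B -> F n (Y n @^-1` B)) ->
  (* Y_{i+1} independent of F_i *)
  (forall i A B, F i A -> measurable B ->
     P (A `&` (Y i.+1 @^-1` B)) = (P A * P (Y i.+1 @^-1` B))%E) ->
  (* Y_{i+1} has the law of Y_1 *)
  (forall i B, measurable B -> P (Y i.+1 @^-1` B) = P (Y 1%N @^-1` B)) ->
  (* R is G-measurable *)
  (forall n, measurable (Req T n)) ->
  (0 < P (Rfin T))%E ->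
  [/\ stmt_b P F Y T -> stmt_a P F Y T,
      stmt_ii P F T -> stmt_i P F Y T,
      (forall n, completion P (join (F n) (sigma_of setT (prod_sigma E) (Box Y n)))
                   (Req T n)) ->
        (stmt_a P F Y T -> stmt_b P F Y T) /\ (stmt_i P F Y T -> stmt_ii P F T),
      (forall G Fs G' Fs', b_witness P F Y T G Fs -> b_witness P F Y T G' Fs' ->
         P (Box Y 0 @^-1` ((G `\` G') `|` (G' `\` G))) = 0%E /\
         forall n, (0 < P (Req T n))%E -> as_eq P (Fs n) (Fs' n))
    & (forall G Fs, b_witness P F Y T G Fs ->
         forall B, prod_sigma E B ->
           condP P (Rfin T) (BoxR Y T @^-1` B)
             = condP P (Box Y 0 @^-1` G) (Box Y 0 @^-1` B)
           /\ condP P (Rfin T) (BoxR Y T @^-1` B)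
             = fine (P (Box Y 0 @^-1` (B `&` G))) / fine (P (Box Y 0 @^-1` G)))].
Proof.
move=> filtF adY indY idY mR RT0.
have lawE G Fs B := law_b_witness P F Y filtF adY indY idY T mR RT0 G Fs B.
have b_a : stmt_b P F Y T -> stmt_a P F Y T.
  move=> [G [Fs bw]].
  exact: (b_witness_independent P F Y filtF adY indY idY T mR RT0 G Fs).
have a_b := stmt_a_b_witness P F Y filtF adY indY idY T mR RT0.
split => //.
- move=> sT; have [Fs bw] := stopping_b_witness P F Y filtF T sT.
  split; first by apply: b_a; exists setT, Fs.
  (* For [G := setT] the conditioning is trivial, and the formula gives the law of the sequence
     itself. *)
  move=> B mB; rewrite (lawE _ _ _ bw mB) setIT preimage_setT probability_setT.
  by rewrite divr1.
- move=> cR; split; first exact: a_b.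
  move=> si; have [G [Fs bw]] := a_b cR si.1.
  exact: (stmt_i_stopping P F Y filtF adY indY idY T mR RT0 G Fs).
- exact: (b_witness_unique P F Y filtF adY indY idY T mR RT0).
- by move=> G Fs bw B mB; rewrite (lawE _ _ _ bw mB) /condP preimage_setI.
Qed.
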